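(* Let $f:[0,1]\to\mathbb R$ be of class $C^1$ with $f(0)=f(1)=0$, $f>0$ in $(0,1)$ and $f'(0)=0$. Let $u_0:\mathbb R\to[0,1]$ be uniformly continuous with $u_0>0$ in $\mathbb R$, $\liminf_{x\to-\infty}u_0(x)>0$ and $\lim_{x\to+\infty}u_0(x)=0$. Let $u(t,x)$ be the solution of $\partial_t u=\partial_{xx}u+f(u)$ for $t>0$, $x\in\mathbb R$, with initial condition $u(0,\cdot)=u_0$, and let $E_\lambda(t)$ and $t_\lambda$ be as defined in the context. Let $\alpha>0$ and $\beta>1$ be such that $$\beta<1+\frac1\alpha .$$ Assume that there are $C>0$ and $x_0>1$ such that $$u_0(x)\geq\frac{C}{x^\alpha},\quad\forall x\geq x_0.$$ Assume that there are $r>0$, $\delta>0$ and $s_0\in(0,1)$ such that $$f(s)\geq r s^\beta(1-s^\delta),\quad\forall\, 0\leq s\leq s_0.$$ Then, for any $\lambda\in(0,1)$ and any small $\varepsilon>0$, there is a time $T_{\lambda,\varepsilon}\geq t_\lambda$ such that $$E_\lambda(t)\subset(x^-(t),+\infty)\quad\forall t\geq T_{\lambda,\varepsilon},\qquad x^-(t):=\left((r-\varepsilon)C^{\beta-1}(\beta-1)t\right)^{\frac{1}{\alpha(\beta-1)}}.$$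
   Context: For $\lambda\in(0,1)$ and $t\geq 0$, $E_\lambda(t):=\{x\in\mathbb R:\ u(t,x)=\lambda\}$ denotes the $\lambda$-level set of $u(t,\cdot)$. Under the stated assumptions on $f$ and $u_0$ one has $0<u(t,x)<1$ for all $t>0$, $x\in\mathbb R$; there is $\gamma>0$ such that $\lim_{t\to\infty}\inf_{x\leq\gamma t}u(t,x)=1$; and $\lim_{x\to+\infty}u(t,x)=0$ for every $t\geq0$. Such a $\gamma>0$ is fixed. Consequently, for any $\lambda\in(0,1)$ there is a time $t_\lambda>0$, which is fixed, such that $\emptyset\neq E_\lambda(t)\subset(\gamma t,+\infty)$ for all $t\geq t_\lambda$. *)

(* Defs.v *)
From mathcomp Require Import all_boot all_order all_algebra.
From mathcomp Require Import all_classical all_reals all_analysis.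

Set Implicit Arguments.
Unset Strict Implicit.
Unset Printing Implicit Defensive.

Import Order.TTheory GRing.Theory Num.Theory.
Import numFieldNormedType.Exports.

Local Open Scope classical_set_scope.
Local Open Scope ring_scope.

(* Derivative relative to D. At an endpoint of D = `[0, 1] this is the
   one-sided derivative, and only the values of f on D (and at x) matter. *)
Definition has_derivative_in (R : realType) (D : set R) (f : R -> R)
    (x l : R) : Prop :=
  (f y - f x) / (y - x) @[y --> within D x^'] --> l.

Definition C1_on (R : realType) (D : set R) (f : R -> R) : Prop :=
  exists2 df : R -> R,
    (forall x : R, D x -> has_derivative_in D f x (df x))
    & {within D, continuous df}.

(* Classical [0, 1]-valued solution of u_t = u_xx + f(u), u(0, .) = u0, in
   C([0, +oo[ x R) and C^{1,2}(]0, +oo[ x R). The first argument of u is time;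
   its values at negative times are irrelevant. The range condition makes
   f(u) meaningful, since f is only given on [0, 1]. *)
Record is_solution (R : realType) (f u0 : R -> R) (u : R -> R -> R) : Prop :=
  IsSolution {
  sol_range : forall t x : R, 0 <= t -> 0 <= u t x <= 1;
  sol_init : forall x : R, u 0 x = u0 x;
  sol_cont : {within [set p : R * R | 0 <= p.1],
               continuous (fun p : R * R => u p.1 p.2)};
  sol_derivable_t : forall t x : R, 0 < t -> derivable (fun s => u s x) t 1;
  sol_derivable_x : forall t x : R, 0 < t -> derivable (u t) x 1;
  sol_derivable_xx : forall t x : R, 0 < t -> derivable (derive1 (u t)) x 1;
  sol_cont_t : forall p : R * R, 0 < p.1 ->
    {for p, continuous (fun q : R * R => derive1 (fun s => u s q.2) q.1)};
  sol_cont_x : forall p : R * R, 0 < p.1 ->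
    {for p, continuous (fun q : R * R => derive1 (u q.1) q.2)};
  sol_cont_xx : forall p : R * R, 0 < p.1 ->
    {for p, continuous (fun q : R * R => derive1n 2 (u q.1) q.2)};
  sol_eq : forall t x : R, 0 < t ->
    derive1 (fun s => u s x) t = derive1n 2 (u t) x + f (u t x)
}.

Definition level_set (R : realType) (u : R -> R -> R) (lambda t : R) : set R :=
  [set x | u t x = lambda].

(* Main.v *)
Require Import Defs.
From mathcomp Require Import all_boot all_order all_algebra.
From mathcomp Require Import all_classical all_reals all_analysis.
From mathcomp Require Import lra ring.

Set Implicit Arguments.
Unset Strict Implicit.
Unset Printing Implicit Defensive.

Import Order.TTheory GRing.Theory Num.Theory.
Import numFieldNormedType.Exports.

Local Open Scope classical_set_scope.
Local Open Scope ring_scope.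

(** Why the level sets accelerate at least like t^(1/(alpha (beta - 1))).

Write b = beta - 1, p = alpha b and B = C^(-b).  Without diffusion, the
equation w_t = rho w^beta started from C / x^alpha is solved by
w = (B x^p - rho b t)^(-1/b), whose level sets move like
(rho C^b b t)^(1/p).  The assumption beta < 1 + 1/alpha says p < 1.  Hence
x^p is concave with a slope that vanishes at infinity, w depends on x only
through a slowly varying quantity, and diffusion is harmless far to the right.

Since w blows up in finite time, it is replaced by the travelling-type function
  v(t, x) = front(rho b t - B x^p - K),
  front(xi) = (L^(-b) + softplus(xi))^(-1/b),   lambda < L < 1,
where softplus is a smooth convex positive decreasing function, asymptotic to
-xi at -oo and tending to 0 at +oo.  So front looks like (-xi)^(-1/b) at -oo and
saturates at L at +oo.  When the smoothing length a of softplus is large,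
front is so flat outside the region of small values that
rho b front' <= eta front'' + f(front) for all 0 <= eta <= 1
(front_subsolution): for small values, f(s) >= r1 s^beta with rho < r1 < r
wins, and for larger values, f is bounded below while front' is O(1/a).
With eta = (B p x^(p-1))^2, this makes v a subsolution for x >= X.

It remains to compare v with u on [X, +oo[ (wave_below_solution).  At time 0,
v <= (B x^p)^(-1/b) = C / x^alpha <= u0.  On the boundary x = X, after some
time t1 the solution exceeds L > v, since u tends to 1 behind the speed gamma.
Up to time t1, u(., X) is bounded below by a positive constant
(solution_lower_bound), and the shift K is taken so large that v is still
smaller than it.  The shift costs only a constant in xi, which the difference
between rho = r - epsilon / 2 and r - epsilon absorbs for large t.

The comparison itself is the parabolic minimum principle on rectangles
[0, T] x [X, Y], where the error made at the artificial boundary Y tends to 0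
because v vanishes at +oo locally uniformly in time. *)

(** * Derivative tests at a minimum *)

Lemma slope_ltN (R : realType) (g : R -> R) (c l : R) :
  is_derive c 1 g l -> l < 0 ->
  exists2 e : R, 0 < e &
    forall y, y != c -> `|y - c| < e -> (g y - g c) / (y - c) < 0.
Proof.
move=> [dg gl] l0.
have lim : h^-1 *: (g (h *: 1 + c) - g c) @[h --> 0^'] --> l.
  by rewrite -gl; exact: dg.
have := cvgr_lt l lim 0 l0.
rewrite near_withinE => /(_ _) /nbhs_ballP[e /= e0 He].
exists e => // y yc ye.
have := He (y - c).
rewrite /ball /= sub0r normrN => /(_ ye); rewrite subr_eq0 => /(_ yc).
by rewrite /GRing.scale /= mulr1 subrK mulrC.
Qed.

(** If the second derivative were negative at the minimum, the first derivative,
which vanishes there, would be negative just to the right, and the mean value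
theorem would produce smaller values. *)
Lemma second_derivative_at_min (R : realType) (g g1 : R -> R) (g2 a b c : R) :
  c \in `]a, b[ -> (forall x, x \in `]a, b[ -> is_derive x 1 g (g1 x)) ->
  is_derive c 1 g1 g2 -> (forall x, x \in `]a, b[ -> g c <= g x) -> 0 <= g2.
Proof.
move=> cab dg dg1 gmin; rewrite leNgt; apply/negP => g2lt0.
have g1c0 : g1 c = 0.
  have ab : a <= b by move: cab; rewrite in_itv /= => /andP[ac cb]; lra.
  have dg' t : t \in `]a, b[ -> derivable g t 1 by move=> /dg [].
  have [_ <-] := derive1_at_min ab dg' cab gmin.
  by have [_ <-] := dg c cab.
have [e e0 He] := slope_ltN dg1 g2lt0.
move: (cab); rewrite in_itv /= => /andP[ac cb].
pose y := c + Num.min (e / 2) ((b - c) / 2).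
have [cy ye yb] : [/\ c < y, y - c < e & y < b].
  by rewrite /y; case: (leP (e / 2) ((b - c) / 2)) => ?; split; lra.
have dcy x : x \in `]c, y[ -> is_derive x 1 g (g1 x).
  rewrite in_itv /= => /andP[? ?]; apply: dg; rewrite in_itv /=.
  by apply/andP; split; lra.
have [] := MVT cy dcy.
  apply: derivable_within_continuous => x; rewrite in_itv /= => /andP[? ?].
  suff: is_derive x 1 g (g1 x) by case.
  by apply: dg; rewrite in_itv /=; apply/andP; split; lra.
move=> z; rewrite in_itv /= => /andP[cz zy] gz.
have zc : z != c by rewrite gt_eqF.
have := He z zc; rewrite g1c0 subr0 gtr0_norm ?subr_gt0// => /(_ _).
rewrite pmulr_llt0 ?invr_gt0 ?subr_gt0// => /(_ ltac:(lra)) g1z.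
have := gmin y; rewrite in_itv /= yb (lt_trans ac cy) => /(_ isT).
by rewrite -subr_ge0 gz nmulr_rge0// subr_le0 leNgt cy.
Qed.

(** The one-sided test: in the minimum principle the minimum may be attained at
the final time, where only earlier times are available. *)
Lemma derivative_at_left_min (R : realType) (g : R -> R) (l a c : R) :
  a < c -> is_derive c 1 g l -> (forall x, a < x <= c -> g c <= g x) -> l <= 0.
Proof.
move=> ac dg gmin; rewrite leNgt; apply/negP => l0.
have dNg : is_derive c 1 (- g) (- l) by apply: is_deriveN.
have [e e0 He] := slope_ltN dNg ltac:(lra).
pose y := c - Num.min (e / 2) ((c - a) / 2).
have [yc ye ay] : [/\ y < c, c - y < e & a < y].
  by rewrite /y; case: (leP (e / 2) ((c - a) / 2)) => ?; split; lra.
have := He y; rewrite lt_eqF// distrC gtr0_norm ?subr_gt0// => /(_ isT ye).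
rewrite nmulr_llt0 ?invr_lt0 ?subr_lt0//= !fctE opprK addrC subr_gt0.
by have := gmin y; rewrite ay ltW// => /(_ isT); lra.
Qed.

(** * The parabolic minimum principle *)

Lemma within_continuousM (R : realType) (T : topologicalType) (A : set T)
    (g h : T -> R) :
  {within A, continuous g} -> {within A, continuous h} ->
  {within A, continuous (fun x => g x * h x)}.
Proof. by move=> cg ch x; exact: (cvgM (cg x) (ch x)). Qed.

Lemma is_derive_expR_lin (R : realType) (k t : R) :
  is_derive t 1 (fun s => expR (k * s)) (k * expR (k * t)).
Proof.
have dl : is_derive t 1 (fun s => k * s) k.
  by apply: is_derive_eq; rewrite /GRing.scale /= mulr1.
by apply: is_derive_eq (is_derive1_comp _ dl) _; rewrite mulrC.
Qed.

(** The weight expR (- (M + 1) t) turns the inequality z_t >= z_xx + M z, valid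
where z < 0, into a contradiction at a negative interior minimum of the
weighted function: there z_xx >= 0 and z_t <= (M + 1) z, so M z <= (M + 1) z
although z < 0.  Only points with z < 0 matter, and the partial derivatives are
given as functions, so that z need not be smooth outside the rectangle. *)
Lemma minimum_principle (R : realType) (z zt zx zxx : R -> R -> R)
    (M d T a b : R) :
  0 <= M -> 0 <= d -> 0 <= T -> a <= b ->
  {within `[0, T] `*` `[a, b], continuous (fun p : R * R => z p.1 p.2)} ->
  (forall t x, 0 < t <= T -> a < x < b -> is_derive t 1 (z^~ x) (zt t x)) ->
  (forall t x, 0 < t <= T -> a < x < b -> is_derive x 1 (z t) (zx t x)) ->
  (forall t x, 0 < t <= T -> a < x < b -> is_derive x 1 (zx t) (zxx t x)) ->
  (forall t x, 0 < t <= T -> a < x < b -> z t x < 0 ->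
     zxx t x + M * z t x <= zt t x) ->
  (forall x, a <= x <= b -> - d <= z 0 x) ->
  (forall t, 0 <= t <= T -> - d <= z t a) ->
  (forall t, 0 <= t <= T -> - d <= z t b) ->
  forall t x, 0 <= t <= T -> a <= x <= b ->
    - d * expR ((M + 1) * t) <= z t x.
Proof.
move=> M0 d0 T0 ab zc dzt dzx dzxx zeq z_init z_a z_b t x tT xab.
pose k := - (M + 1).
pose w (p : R * R) := expR (k * p.1) * z p.1 p.2.
have wc : {within `[0, T] `*` `[a, b], continuous w}.
  apply: within_continuousM zc.
  apply: continuous_subspaceT => q.
  have kq : {for q, continuous (fun p : R * R => k * p.1)}.
    by apply: continuousM; [exact: cst_continuous|exact: cvg_fst].
  exact: (continuous_comp kq (@continuous_expR R _)).
have rect0 : `[0, T] `*` `[a, b] !=set0.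
  by exists (t, x); split => /=; rewrite in_itv.
have rect_cpt : compact (`[0, T] `*` `[a, b]).
  by apply: compact_setX; exact: segment_compact.
have [[t0 x0]] := compact_EVT_min rect0 rect_cpt wc.
rewrite inE => -[/=]; rewrite !in_itv /= => tT0 xab0 wmin.
rewrite leNgt; apply/negP => ztx.
have wtx : w (t, x) < - d.
  rewrite /w /= /k mulNr expRN mulrC ltr_pdivrMr ?expR_gt0//.
have {}wmin s y : 0 <= s <= T -> a <= y <= b -> w (t0, x0) <= w (s, y).
  by move=> sT yab; apply: wmin; rewrite inE; split => /=; rewrite in_itv.
have w0 : w (t0, x0) < - d by apply: le_lt_trans wtx; exact: wmin.
have z0 : z t0 x0 < 0.
  have : w (t0, x0) < 0 by rewrite (lt_le_trans w0)// oppr_le0.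
  by rewrite /w /= pmulr_rlt0 ?expR_gt0.
have zd : z t0 x0 < - d.
  apply: le_lt_trans w0; rewrite /w /= -[leLHS]mul1r ler_nM2r// -expR0 ler_expR.
  by rewrite /k mulNr oppr_le0 mulr_ge0//; [lra|case/andP: tT0].
move/andP: (tT0) => [t0ge t0T]; move/andP: (xab0) => [ax0 x0b].
have t0gt : 0 < t0.
  rewrite lt_neqAle t0ge andbT; apply/eqP => t0E.
  by move: zd; rewrite -t0E ltNge z_init.
have x0in : a < x0 < b.
  rewrite !lt_neqAle ax0 x0b !andbT; apply/andP; split; apply/eqP => xE.
    by move: zd; rewrite -xE ltNge z_a.
  by move: zd; rewrite xE ltNge z_b.
have t0in : 0 < t0 <= T by rewrite t0gt.
have zxx_ge0 : 0 <= zxx t0 x0.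
  apply: (@second_derivative_at_min _ (z t0) (zx t0) _ a b x0).
  - by rewrite in_itv.
  - by move=> y; rewrite in_itv /= => yab; apply: dzx.
  - exact: dzxx.
  - move=> y; rewrite in_itv /= => /andP[ay yb].
    have := wmin t0 y tT0; rewrite (ltW ay) (ltW yb) => /(_ isT).
    by rewrite /w /= ler_pM2l ?expR_gt0.
have : expR (k * t0) * zt t0 x0 + z t0 x0 * (k * expR (k * t0)) <= 0.
  apply: (@derivative_at_left_min _ (fun s => w (s, x0)) _ 0 t0 t0gt).
    by apply: is_deriveM; [exact: is_derive_expR_lin|exact: dzt].
  by move=> s /andP[s0 st]; apply: wmin; rewrite ?ax0// (ltW s0) (le_trans st).
rewrite (_ : _ + _ = expR (k * t0) * (zt t0 x0 + k * z t0 x0)); last by ring.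
rewrite pmulr_rle0 ?expR_gt0// => zt_le.
have := zeq _ _ t0in x0in z0; rewrite /k in zt_le.
move: zt_le zxx_ge0 z0; lra.
Qed.

(** * Reaction terms of class C^1 on a segment *)

Lemma has_derivative_in_eps (R : realType) (D : set R) (f : R -> R) (x l : R) :
  has_derivative_in D f x l -> forall e, 0 < e ->
  exists2 h, 0 < h & forall y, D y -> y != x -> `|y - x| < h ->
    `|l - (f y - f x) / (y - x)| < e.
Proof.
move=> /cvgrPdist_lt dfx e e0; have := dfx e e0.
rewrite !near_withinE => /nbhs_ballP[h /= h0 Hh].
exists h => // y Dy yx yh; apply: Hh => //.
by rewrite /ball /= distrC.
Qed.

Lemma C1_on_continuous (R : realType) (D : set R) (f : R -> R) :
  C1_on D f -> {within D, continuous f}.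
Proof.
move=> [df dfP _]; apply/subspace_continuousP => x Dx.
apply/cvgrPdist_lt => e e0; rewrite near_withinE.
have [h h0 Hh] := has_derivative_in_eps (dfP x Dx) ltr01.
pose k := `|df x| + 1.
have k0 : 0 < k by rewrite /k ltr_wpDl.
apply/nbhs_ballP; exists (Num.min h (e / k)) => [|y] /=.
  by rewrite lt_min h0 divr_gt0.
rewrite /ball /= lt_min distrC => /andP[yh ye] Dy.
have [->|yx] := eqVneq y x; first by rewrite subrr normr0.
have yx0 : 0 < `|y - x| by rewrite normr_gt0 subr_eq0.
have slope : `|(f y - f x) / (y - x)| < k.
  have := Hh y Dy yx yh; rewrite distrC => /(le_lt_trans (lerB_dist _ _)).
  by rewrite /k; lra.
have -> : f x - f y = - ((f y - f x) / (y - x) * (y - x)).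
  by rewrite mulfVK ?opprB// subr_eq0.
rewrite normrN normrM; apply: lt_trans (_ : k * `|y - x| < _).
  by rewrite ltr_pM2r.
by rewrite mulrC -ltr_pdivlMr.
Qed.

Lemma has_derivative_in_interior (R : realType) (f : R -> R) (a b x l : R) :
  a < x < b -> has_derivative_in `[a, b] f x l -> is_derive x 1 f l.
Proof.
move=> /andP[ax xb] dfx.
have lim : h^-1 *: (f (h *: 1 + x) - f x) @[h --> 0^'] --> l.
  apply/cvgrPdist_lt => e e0; rewrite near_withinE.
  have [h h0 Hh] := has_derivative_in_eps dfx e0.
  apply/nbhs_ballP; exists (Num.min h (Num.min (x - a) (b - x))) => [|y] /=.
    by rewrite !lt_min h0 !subr_gt0 ax xb.
  rewrite /ball /= sub0r normrN !lt_min => /and3P[yh ya yb] y0.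
  rewrite /GRing.scale /= mulr1 (mulrC y^-1).
  have := Hh (y + x); rewrite addrK; apply.
  - move: ya yb; rewrite !ltr_norml /= in_itv /= => /andP[? ?] /andP[? ?].
    by apply/andP; split; lra.
  - by rewrite -subr_eq0 addrK.
  - exact: yh.
by split; [apply/cvg_ex; exists l|exact: cvg_lim lim].
Qed.

(** The one-sided Lipschitz bound that the comparison of two solutions needs; the
constant is the maximum of the derivative. *)
Lemma C1_on_lipschitz (R : realType) (f : R -> R) :
  C1_on `[0, 1] f -> exists2 M, 0 <= M &
    forall x y, 0 <= x <= 1 -> 0 <= y <= 1 -> x <= y -> f y - f x <= M * (y - x).
Proof.
move=> fC1; have fc := C1_on_continuous fC1.
case: fC1 => df dfP dfc.
have [c c01 cmax] := EVT_max ler01 dfc.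
exists (Num.max 0 (df c)); first by rewrite le_max lexx.
move=> x y /andP[x0 x1] /andP[y0 y1]; rewrite le_eqVlt => /orP[/eqP->|xy].
  by rewrite !subrr mulr0.
have dfxy z : z \in `]x, y[ -> is_derive z 1 f (df z).
  rewrite in_itv /= => /andP[? ?].
  apply: (@has_derivative_in_interior _ _ 0 1); first by apply/andP; split; lra.
  by apply: dfP; rewrite /= in_itv /=; apply/andP; split; lra.
have fcxy : {within `[x, y], continuous f}.
  apply: continuous_subspaceW fc => z /=; rewrite !in_itv /= => /andP[? ?].
  by apply/andP; split; lra.
have [z] := MVT xy dfxy fcxy; rewrite in_itv /= => /andP[xz zy] ->.
rewrite ler_pM2r ?subr_gt0// le_max; apply/orP; right.
by apply: cmax; rewrite in_itv /=; apply/andP; split; lra.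
Qed.

(** * Negative powers *)

Lemma le_powRN (R : realType) (x y k : R) :
  0 <= k -> 0 < x -> x <= y -> y `^ (- k) <= x `^ (- k).
Proof.
move=> k0 x0 xy; have y0 := lt_le_trans x0 xy.
rewrite !powRN lef_pV2 ?posrE ?powR_gt0//.
by apply: ge0_ler_powR => //; rewrite nnegrE ltW.
Qed.

Lemma lt_powRN (R : realType) (x y k : R) :
  0 < k -> 0 < x -> x < y -> y `^ (- k) < x `^ (- k).
Proof.
move=> k0 x0 xy; have y0 := lt_trans x0 xy.
rewrite !powRN ltf_pV2 ?posrE ?powR_gt0//.
by apply: gt0_ltr_powR => //; rewrite nnegrE ltW.
Qed.

Lemma powRN_invK (R : realType) (x k : R) :
  0 < k -> 0 <= x -> (x `^ (- k)) `^ (- k^-1) = x.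
Proof. by move=> k0 x0; rewrite -powRrM mulrNN mulfV ?gt_eqF// powRr1. Qed.

Lemma powRNV_invK (R : realType) (x k : R) :
  0 < k -> 0 <= x -> (x `^ (- k^-1)) `^ (- k) = x.
Proof. by move=> k0 x0; rewrite -powRrM mulrNN mulVf ?gt_eqF// powRr1. Qed.

(** * The saturating profile *)

(** A convex smoothing, at scale a, of the negative part max (- xi, 0). *)
Definition softplus (R : realType) (a xi : R) : R :=
  a * ln (1 + expR (- a^-1 * xi)).

(** Minus the derivative of softplus, i.e. e / (1 + e) with e = expR (- xi / a);
written this way it is compared with softplus by expR y >= 1 + y. *)
Definition logistic (R : realType) (a xi : R) : R :=
  1 - (1 + expR (- a^-1 * xi))^-1.

Lemma expR1D_gt1 (R : realType) (x : R) : 1 < 1 + expR x.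
Proof. by rewrite ltrDl expR_gt0. Qed.

Lemma expR1D_gt0 (R : realType) (x : R) : 0 < 1 + expR x.
Proof. exact: lt_trans (expR1D_gt1 x). Qed.

Lemma softplus_gt0 (R : realType) (a xi : R) : 0 < a -> 0 < softplus a xi.
Proof. by move=> a0; rewrite mulr_gt0// ln_gt0// expR1D_gt1. Qed.

Lemma softplus_geN (R : realType) (a xi : R) : 0 < a -> - xi <= softplus a xi.
Proof.
move=> a0; rewrite -ler_pdivrMl// -[leLHS]expRK ler_ln
  ?posrE ?expR_gt0 ?expR1D_gt0//.
by rewrite mulrN -mulNr lerDr.
Qed.

Lemma softplus_le_expR (R : realType) (a xi : R) :
  0 < a -> softplus a xi <= a * expR (- a^-1 * xi).
Proof.
move=> a0.
by rewrite ler_pM2l// le_ln1Dx// (lt_trans _ (expR_gt0 _))// ltrN10.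
Qed.

Lemma logistic_ge0 (R : realType) (a xi : R) : 0 <= logistic a xi.
Proof. by rewrite subr_ge0 invf_le1 ?expR1D_gt0// ltW// expR1D_gt1. Qed.

Lemma logistic_le1 (R : realType) (a xi : R) : logistic a xi <= 1.
Proof. by rewrite gerBl invr_ge0 ltW// expR1D_gt0. Qed.

(** With y = ln (1 + e), this is 1 - expR (- y) <= y.  It says that the slope of
softplus is O(1/a) wherever softplus is bounded. *)
Lemma logistic_le_softplus (R : realType) (a xi : R) :
  0 < a -> logistic a xi <= softplus a xi / a.
Proof.
move=> a0; rewrite /softplus mulrAC mulfV ?gt_eqF// mul1r.
rewrite /logistic lerBlDr -lerBlDl.
rewrite -[X in _ <= X^-1]lnK ?posrE ?expR1D_gt0// -expRN.
exact: expR_ge1Dx.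
Qed.

Lemma is_derive_softplus (R : realType) (a xi : R) : 0 < a ->
  is_derive xi 1 (softplus a) (- logistic a xi).
Proof.
move=> a0; have e0 := expR1D_gt0 (- a^-1 * xi).
have dE := is_derive_expR_lin (- a^-1) xi.
have d1 : is_derive xi 1 (fun y => 1 + expR (- a^-1 * y))
    (- a^-1 * expR (- a^-1 * xi)).
  exact: is_derive_eq (is_deriveD (is_derive_cst (1 : R^o) _ _) dE) (add0r _).
have dln := @is_derive1_comp R (@ln R) _ xi _ _ (is_derive1_ln e0) d1.
apply: is_derive_eq (is_deriveZ a dln) _.
rewrite /logistic /GRing.scale /=.
by field; rewrite !gt_eqF.
Qed.

Lemma is_derive_logistic (R : realType) (a xi : R) : 0 < a ->
  is_derive xi 1 (logistic a) (- (logistic a xi * (1 - logistic a xi) / a)).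
Proof.
move=> a0; have e0 := expR1D_gt0 (- a^-1 * xi).
have dE := is_derive_expR_lin (- a^-1) xi.
have d1 : is_derive xi 1 (fun y => 1 + expR (- a^-1 * y))
    (- a^-1 * expR (- a^-1 * xi)).
  exact: is_derive_eq (is_deriveD (is_derive_cst (1 : R^o) _ _) dE) (add0r _).
have dV := @is_deriveV R _ xi _ _ (lt0r_neq0 e0) d1.
apply: is_derive_eq; rewrite add0r /logistic /GRing.scale /=.
by field; rewrite !gt_eqF.
Qed.

Definition front_base (R : realType) (L b a xi : R) : R :=
  L `^ (- b) + softplus a xi.

(** L^(-b) in the base makes the profile saturate at L; the power -1/b makes it
solve w' = w^(1+b) / b up to the factor logistic. *)
Definition front (R : realType) (L b a xi : R) : R :=
  front_base L b a xi `^ (- b^-1).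

Definition front' (R : realType) (L b a xi : R) : R :=
  b^-1 * (front_base L b a xi `^ (- b^-1 - 1) * logistic a xi).

Definition front'' (R : realType) (L b a xi : R) : R :=
  b^-1 * ((b^-1 + 1) * front_base L b a xi `^ (- b^-1 - 1 - 1) *
            logistic a xi ^+ 2
          - front_base L b a xi `^ (- b^-1 - 1) *
            (logistic a xi * (1 - logistic a xi) / a)).

Lemma front_base_gt0 (R : realType) (L b a xi : R) :
  0 < a -> 0 < front_base L b a xi.
Proof. by move=> a0; rewrite ltr_wpDl ?powR_ge0// softplus_gt0. Qed.

Lemma front_gt0 (R : realType) (L b a xi : R) : 0 < a -> 0 < front L b a xi.
Proof. by move=> a0; rewrite powR_gt0// front_base_gt0. Qed.

Lemma front_ltL (R : realType) (L b a xi : R) :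
  0 < a -> 0 < b -> 0 < L -> front L b a xi < L.
Proof.
move=> a0 b0 L0; rewrite -[ltRHS](powRN_invK b0 (ltW L0)).
by rewrite lt_powRN ?invr_gt0 ?powR_gt0// ltrDl softplus_gt0.
Qed.

(** From softplus xi >= - xi: the profile lies below the blowing-up solution
(- xi)^(-1/b). *)
Lemma front_le (R : realType) (L b a m xi : R) :
  0 < a -> 0 < b -> 0 < m -> xi <= - m `^ (- b) -> front L b a xi <= m.
Proof.
move=> a0 b0 m0 xim; rewrite -[leRHS](powRN_invK b0 (ltW m0)).
apply: le_powRN; rewrite ?invr_ge0 ?powR_gt0 ?(ltW b0)//.
have := softplus_geN xi a0; have := powR_ge0 L (- b).
by rewrite /front_base; lra.
Qed.

Lemma front_gt_near_limit (R : realType) (L b a s : R) :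
  0 < a -> 0 < b -> 0 < s < L ->
  exists xi0, forall xi, xi0 <= xi -> s < front L b a xi.
Proof.
move=> a0 b0 /andP[s0 sL]; have L0 := lt_trans s0 sL.
pose d := s `^ (- b) - L `^ (- b).
have d0 : 0 < d by rewrite subr_gt0 lt_powRN.
exists (1 - a * ln (d / a)) => xi xi_ge.
rewrite -[ltLHS](powRN_invK b0 (ltW s0)).
rewrite lt_powRN ?invr_gt0 ?front_base_gt0//.
rewrite /front_base -ltrBrDl.
apply: le_lt_trans (softplus_le_expR xi a0) _.
rewrite -ltr_pdivlMl// (mulrC a^-1 d) -[ltRHS]lnK ?posrE ?divr_gt0// ltr_expR.
by rewrite mulNr ltrNl ltr_pdivlMl// mulrN; lra.
Qed.

Lemma is_derive_front_base_powR (R : realType) (L b a k xi : R) : 0 < a ->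
  is_derive xi 1 (fun y => front_base L b a y `^ k)
    (- k * front_base L b a xi `^ (k - 1) * logistic a xi).
Proof.
move=> a0.
have dsp := is_derive_softplus xi a0.
have dbase : is_derive xi 1 (front_base L b a) (- logistic a xi).
  exact: is_derive_eq (is_deriveD (is_derive_cst (L `^ (- b) : R^o) _ _) dsp)
           (add0r _).
have dpow := is_derive1_powR k (front_base_gt0 L b xi a0).
apply: is_derive_eq (@is_derive1_comp R (@powR R ^~ k) _ xi _ _ dpow dbase) _.
by ring.
Qed.

Lemma is_derive_front (R : realType) (L b a xi : R) : 0 < a ->
  is_derive xi 1 (front L b a) (front' L b a xi).
Proof.
move=> a0; apply: is_derive_eq (is_derive_front_base_powR _ _ _ _ a0) _.
by rewrite opprK /front' mulrA.
Qed.

Lemma is_derive_front' (R : realType) (L b a xi : R) : 0 < a ->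
  is_derive xi 1 (front' L b a) (front'' L b a xi).
Proof.
move=> a0.
have dpow := is_derive_front_base_powR L b (- b^-1 - 1) xi a0.
have dlog := is_derive_logistic xi a0.
apply: is_derive_eq (is_deriveZ b^-1 (is_deriveM dpow dlog)) _.
by rewrite /front'' /GRing.scale /=; ring.
Qed.

Lemma front'_ge0 (R : realType) (L b a xi : R) : 0 < b -> 0 <= front' L b a xi.
Proof.
by move=> b0; rewrite !mulr_ge0 ?invr_ge0 ?powR_ge0 ?logistic_ge0// ltW.
Qed.

(** The factor of the derivatives of the profile is the nonlinearity itself. *)
Lemma front_powR (R : realType) (L b a xi : R) : 0 < b ->
  front L b a xi `^ (1 + b) = front_base L b a xi `^ (- b^-1 - 1).
Proof.
by move=> b0; rewrite -powRrM; congr powR; field; rewrite gt_eqF.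
Qed.

(** After division by front^(1+b), the first derivative contributes rho times the
logistic factor, and the concave part of the second one at most 1/(a b).
Where front <= s1, the logistic factor is bounded by 1 and the two terms are
paid by r1.  Where front > s1, softplus is at most s1^(-b), the logistic factor
is at most s1^(-b) / a, and everything is O(1/a), below the lower bound c
of f. *)
Lemma front_subsolution (R : realType) (f : R -> R)
    (L b a rho r1 s1 c eta xi : R) :
  0 < b -> 0 < L <= 1 -> 0 < s1 -> 0 <= rho -> 
  0 < a -> b^-1 / a <= r1 - rho -> (rho * s1 `^ (- b) + b^-1) / a <= c ->
  (forall s, 0 < s <= s1 -> r1 * s `^ (1 + b) <= f s) ->
  (forall s, s1 <= s < L -> c <= f s) ->
  0 <= eta <= 1 ->
  rho * b * front' L b a xi <= eta * front'' L b a xi + f (front L b a xi).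
Proof.
move=> b0 /andP[L0 L1] s10 rho0 a0 a_r1 a_c f_small f_large /andP[eta0 eta1].
set phi := front L b a xi.
have phi0 : 0 < phi by exact: front_gt0.
have phiL : phi < L by exact: front_ltL.
set P := front_base L b a xi `^ (- b^-1 - 1).
have P0 : 0 <= P by exact: powR_ge0.
have g0 := logistic_ge0 a xi; have g1 := logistic_le1 a xi.
have bV0 : 0 < b^-1 by rewrite invr_gt0.
have curv : - (b^-1 / a * P) <= eta * front'' L b a xi.
  have nonneg : 0 <= b^-1 * ((b^-1 + 1) *
      front_base L b a xi `^ (- b^-1 - 1 - 1) * logistic a xi ^+ 2).
    have b1 : 0 <= b^-1 + 1 by lra.
    by rewrite !mulr_ge0 ?powR_ge0 ?sqr_ge0// ltW.
  have g01 : logistic a xi * (1 - logistic a xi) <= 1 by nra.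
  have bPa : 0 <= b^-1 / a * P by rewrite mulr_ge0// divr_ge0// ltW.
  have low : - (b^-1 / a * P) <= front'' L b a xi.
    rewrite /front'' mulrBr -/P.
    have : b^-1 * (P * (logistic a xi * (1 - logistic a xi) / a)) <= b^-1 / a * P.
      have -> : b^-1 * (P * (logistic a xi * (1 - logistic a xi) / a)) =
        logistic a xi * (1 - logistic a xi) * (b^-1 / a * P) by ring.
      by rewrite ler_piMl.
    by move: nonneg; lra.
  move: low eta0 eta1 bPa; nra.
have -> : rho * b * front' L b a xi = rho * logistic a xi * P.
  by rewrite /front' -/P; field; rewrite gt_eqF.
suff : (rho * logistic a xi + b^-1 / a) * P <= f phi by move: curv; lra.
have PE : P = phi `^ (1 + b) by rewrite front_powR.
have [phis1|s1phi] := leP phi s1.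
  apply: le_trans (f_small _ _); last by rewrite phi0.
  rewrite -PE ler_wpM2r//.
  have : rho * logistic a xi <= rho by rewrite ler_piMr.
  by move: a_r1; lra.
apply: le_trans (f_large _ _); last by rewrite phiL ltW.
apply: le_trans a_c.
have P1 : P <= 1.
  have one : 1 `^ (1 + b) = 1 :> R by rewrite powR1.
  rewrite PE -[leRHS]one.
  apply: ge0_ler_powR; rewrite ?nnegrE ?(ltW phi0)//; first by lra.
  by rewrite (le_trans (ltW phiL)).
have base_le : front_base L b a xi <= s1 `^ (- b).
  rewrite -[leLHS](powRNV_invK b0 (ltW (front_base_gt0 L b xi a0))).
  by rewrite le_powRN// ltW.
have log_le : logistic a xi <= s1 `^ (- b) / a.
  apply: le_trans (logistic_le_softplus xi a0) _.
  rewrite ler_pM2r ?invr_gt0//; apply: le_trans base_le.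
  by rewrite lerDr powR_ge0.
have rate_ge0 : 0 <= rho * logistic a xi + b^-1 / a.
  by apply: addr_ge0; [exact: mulr_ge0|rewrite divr_ge0 ?ltW].
apply: le_trans (_ : rho * logistic a xi + b^-1 / a <= _).
  exact: ler_piMr.
by rewrite mulrDl -mulrA lerD2r ler_wpM2l.
Qed.

(** * Comparison with a solution *)

Lemma unif_continuous_continuous (R : realType) (g : R -> R) :
  unif_continuous g -> continuous g.
Proof.
move=> gu x; apply/cvg_entourageP => E entE.
have gE := gu E entE.
have := nbhs_entourage x gE; apply: filterS => y.
by rewrite /xsection /= inE.
Qed.

Lemma within_continuousB (R : realType) (T : topologicalType) (A : set T)
    (g h : T -> R) :
  {within A, continuous g} -> {within A, continuous h} ->
  {within A, continuous (fun x => g x - h x)}.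
Proof. by move=> cg ch x; exact: (cvgB (cg x) (ch x)). Qed.

Lemma is_derive_derive1 (R : realType) (g : R -> R) (x : R) :
  derivable g x 1 -> is_derive x 1 g (derive1 g x).
Proof. by move=> dg; rewrite derive1E; exact: derivableP. Qed.

(** A slack d is allowed on the parabolic boundary, to be able to cut an unbounded
domain.  The differential inequality for u - v is only used where u < v, which
is why a one-sided Lipschitz bound suffices. *)
Lemma comparison (R : realType) (f u0 : R -> R) (u v vt vx vxx : R -> R -> R)
    (M d T a b : R) :
  is_solution f u0 u ->
  0 <= M ->
  (forall x y, 0 <= x <= 1 -> 0 <= y <= 1 -> x <= y ->
     f y - f x <= M * (y - x)) ->
  0 <= d -> 0 <= T -> a <= b ->
  {within `[0, T] `*` `[a, b], continuous (fun p : R * R => v p.1 p.2)} ->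
  (forall t x, 0 < t <= T -> a < x < b -> is_derive t 1 (v^~ x) (vt t x)) ->
  (forall t x, 0 < t <= T -> a < x < b -> is_derive x 1 (v t) (vx t x)) ->
  (forall t x, 0 < t <= T -> a < x < b -> is_derive x 1 (vx t) (vxx t x)) ->
  (forall t x, 0 < t <= T -> a < x < b -> 0 <= v t x <= 1) ->
  (forall t x, 0 < t <= T -> a < x < b -> vt t x <= vxx t x + f (v t x)) ->
  (forall x, a <= x <= b -> v 0 x <= u 0 x + d) ->
  (forall t, 0 <= t <= T -> v t a <= u t a + d) ->
  (forall t, 0 <= t <= T -> v t b <= u t b + d) ->
  forall t x, 0 <= t <= T -> a <= x <= b ->
    v t x <= u t x + d * expR ((M + 1) * t).
Proof.
move=> sol M0 f_lip d0 T0 ab vc dvt dvx dvxx v01 vsub v_init v_a v_b t x tT xab.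
suff : - d * expR ((M + 1) * t) <= u t x - v t x by lra.
apply: (@minimum_principle R (fun t x => u t x - v t x)
  (fun t x => derive1 (fun s => u s x) t - vt t x)
  (fun t x => derive1 (u t) x - vx t x)
  (fun t x => derive1n 2 (u t) x - vxx t x) M d T a b) => //.
- apply: within_continuousB vc.
  have sub : `[0, T] `*` `[a, b] `<=` [set p : R * R | 0 <= p.1].
    by move=> q [/=]; rewrite in_itv /= => /andP[].
  exact: continuous_subspaceW sub (sol_cont sol).
- move=> s y /andP[s0 sT] yab.
  have du := is_derive_derive1 (@sol_derivable_t _ _ _ _ sol s y s0).
  by apply: is_deriveB => //; apply: dvt => //; rewrite s0.
- move=> s y /andP[s0 sT] yab.
  have du := is_derive_derive1 (@sol_derivable_x _ _ _ _ sol s y s0).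
  by apply: is_deriveB => //; apply: dvx => //; rewrite s0.
- move=> s y /andP[s0 sT] yab.
  have du := is_derive_derive1 (@sol_derivable_xx _ _ _ _ sol s y s0).
  by apply: is_deriveB => //; apply: dvxx => //; rewrite s0.
- move=> s y sT yab z0.
  have s0 : 0 < s by case/andP: sT.
  have u01 := @sol_range _ _ _ _ sol s y (ltW s0).
  have := f_lip _ _ u01 (v01 s y sT yab) ltac:(lra).
  have := vsub s y sT yab; have := @sol_eq _ _ _ _ sol s y s0.
  by lra.
- by move=> y /v_init; lra.
- by move=> s /v_a; lra.
- by move=> s /v_b; lra.
Qed.

(** As a polynomial, so that its derivatives can be computed by rewriting. *)
Definition bump (R : realType) (X : R) : {poly R} :=
  (1 - ('X - X%:P) ^+ 2) ^+ 2.

Lemma bumpE (R : realType) (X x : R) : (bump X).[x] = (1 - (x - X) ^+ 2) ^+ 2.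
Proof. by rewrite /bump !hornerE. Qed.

Lemma bump_deriv2 (R : realType) (X x : R) :
  (deriv (deriv (bump X))).[x] = 12 * (x - X) ^+ 2 - 4.
Proof. by rewrite /bump !(poly.derivE, hornerE) /=; ring. Qed.

(** Positivity of u on a vertical segment, without the strong maximum principle:
with q = (x - X)^2, the function m0 expR (- 9 t) (1 - q)^2 vanishes on the sides
of the unit neighbourhood of X and is a subsolution of the heat equation, since
12 q - 4 + 9 (1 - q)^2 = (3 q - 1)^2 + 4 > 0; moreover f >= 0. *)
Lemma solution_lower_bound (R : realType) (f u0 : R -> R) (u : R -> R -> R)
    (M X T : R) :
  is_solution f u0 u -> 0 <= M ->
  (forall x y, 0 <= x <= 1 -> 0 <= y <= 1 -> x <= y ->
     f y - f x <= M * (y - x)) ->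
  (forall s, 0 <= s <= 1 -> 0 <= f s) ->
  (forall x, 0 < u0 x) -> continuous u0 -> 0 <= T ->
  exists2 m, 0 < m & forall t, 0 <= t <= T -> m <= u t X.
Proof.
move=> sol M0 f_lip f_ge0 u0_gt0 u0c T0.
have [c _ cmin] : exists2 c, c \in `[X - 1, X + 1] &
    forall x, x \in `[X - 1, X + 1] -> u0 c <= u0 x.
  by apply: EVT_min; [lra|exact: continuous_subspaceT].
set m0 := u0 c in cmin.
have m00 : 0 < m0 by exact: u0_gt0.
have m01 : m0 <= 1.
  rewrite /m0 -(sol_init sol).
  by case/andP: (@sol_range _ _ _ _ sol 0 c (lexx 0)).
exists (m0 * expR (- 9 * T)); first by rewrite mulr_gt0 ?expR_gt0.
move=> t tT.
pose v (t x : R) := m0 * expR (- 9 * t) * (bump X).[x].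
have bump01 x : X - 1 <= x <= X + 1 -> 0 <= (bump X).[x] <= 1.
  move=> /andP[? ?]; rewrite bumpE.
  have q0 := sqr_ge0 (x - X).
  have q1 : (x - X) ^+ 2 <= 1 by rewrite expr2; nra.
  move: q0 q1; set q := (x - X) ^+ 2 => q0 q1.
  have q10 : 0 <= 1 - q by rewrite subr_ge0.
  have qq := mulr_ge0 q0 q10.
  by rewrite sqr_ge0 /= expr2; move: qq; lra.
have coef s : 0 <= s -> 0 <= m0 * expR (- 9 * s) <= m0.
  move=> s0; rewrite mulr_ge0 ?expR_ge0 ?(ltW m00)//= ler_piMr ?(ltW m00)//.
  by rewrite -[leRHS]expR0 ler_expR; lra.
have v_edge s x : (x - X) ^+ 2 = 1 -> v s x = 0.
  by move=> xX; rewrite /v bumpE xX; ring.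
have u_ge0 s x : 0 <= s -> 0 <= u s x.
  by move=> s0; case/andP: (@sol_range _ _ _ _ sol s x s0).
have v01 s x : 0 < s <= T -> X - 1 < x < X + 1 -> 0 <= v s x <= 1.
  move=> /andP[s0 _] /andP[ax xb].
  have /andP[? ?] := bump01 x ltac:(by rewrite !ltW).
  have /andP[? ?] := coef s (ltW s0).
  by rewrite /v; apply/andP; split; nra.
suff : v t X <= u t X + 0 * expR ((M + 1) * t).
  rewrite mul0r addr0; apply: le_trans.
  rewrite /v bumpE subrr expr0n subr0 expr1n mulr1 ler_pM2l// ler_expR.
  by case/andP: tT => _; lra.
apply: (@comparison _ f u0 u v (fun s x => - 9 * v s x)
  (fun s x => m0 * expR (- 9 * s) * (deriv (bump X)).[x])
  (fun s x => m0 * expR (- 9 * s) * (deriv (deriv (bump X))).[x])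
  M 0 T (X - 1) (X + 1)) => //.
- lra.
- apply: continuous_subspaceT => p.
  have cE : {for p, continuous (fun p : R * R => m0 * expR (- 9 * p.1))}.
    apply: continuousM; first exact: cst_continuous.
    have c9 : {for p, continuous (fun p : R * R => - 9 * p.1)}.
      by apply: continuousM; [exact: cst_continuous|exact: cvg_fst].
    exact: (continuous_comp c9 (@continuous_expR R _)).
  have cB : {for p, continuous (fun p : R * R => (bump X).[p.2])}.
    have c2 : {for p, continuous (fun p : R * R => p.2)} by exact: cvg_snd.
    exact: (continuous_comp c2 (@continuous_horner R (bump X) _)).
  exact: (continuousM cE cB).
- move=> s x _ _.
  have dE := is_derive_expR_lin (- 9) s.
  have dg : is_derive s 1 (fun y => m0 * (bump X).[x] * expR (- 9 * y))
      (m0 * (bump X).[x] * (- 9 * expR (- 9 * s))) by exact: is_deriveZ.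
  have -> : v^~ x = (fun y => m0 * (bump X).[x] * expR (- 9 * y)).
    by apply/funext => y; rewrite /v; ring.
  by apply: is_derive_eq dg _; rewrite /v; ring.
- move=> s x sT xX; apply: (@le_trans _ _
    (m0 * expR (- 9 * s) * (deriv (deriv (bump X))).[x])).
    rewrite bump_deriv2 /v bumpE mulrCA ler_wpM2l//.
      by have /andP[] := coef s (ltW (andP sT).1).
    have := sqr_ge0 (3 * (x - X) ^+ 2 - 1); set q := (x - X) ^+ 2.
    by rewrite !expr2; lra.
  by rewrite lerDl f_ge0// v01.
- move=> x; rewrite addr0 => xX.
  have : v 0 x <= m0.
    rewrite /v mulr0 expR0 mulr1 ler_piMr ?(ltW m00)//.
    by case/andP: (bump01 x xX).
  move/le_trans; apply; rewrite (sol_init sol); apply: cmin.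
  by rewrite in_itv.
- move=> s /andP[s0 _]; rewrite v_edge ?addr0 ?u_ge0//.
  by ring.
- move=> s /andP[s0 _]; rewrite v_edge ?addr0 ?u_ge0//.
  by ring.
- lra.
Qed.

(** * The accelerating subsolution *)

Lemma is_derive_continuous (R : realType) (g : R -> R) (x l : R) :
  is_derive x 1 g l -> {for x, continuous g}.
Proof. by move=> [/derivable1_diffP dg _]; exact: differentiable_continuous. Qed.

Definition wave (R : realType) (L b a sigma B p K t x : R) : R :=
  front L b a (sigma * t - B * x `^ p - K).

Lemma is_derive_wave_t (R : realType) (L b a sigma B p K t x : R) : 0 < a ->
  is_derive t 1 ((wave L b a sigma B p K)^~ x)
    (sigma * front' L b a (sigma * t - B * x `^ p - K)).
Proof.
move=> a0.
have dxi : is_derive t 1 (fun s => sigma * s - B * x `^ p - K) sigma.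
  apply: is_derive_eq; rewrite !subr0 /GRing.scale /=; ring.
have dfr := is_derive_front L b (sigma * t - B * x `^ p - K) a0.
rewrite mulrC.
exact: (@is_derive1_comp R (front L b a)
  (fun s => sigma * s - B * x `^ p - K) t _ _ dfr dxi).
Qed.

Lemma is_derive_powR_scaled (R : realType) (B k x : R) : 0 < x ->
  is_derive x 1 (fun y => B * y `^ k) (B * (k * x `^ (k - 1))).
Proof.
move=> x0; have dp := is_derive1_powR k x0.
exact: is_deriveZ.
Qed.

Lemma is_derive_wave_arg (R : realType) (sigma B p K t x : R) : 0 < x ->
  is_derive x 1 (fun y => sigma * t - B * y `^ p - K)
    (- (B * (p * x `^ (p - 1)))).
Proof.
move=> x0; have dp := is_derive_powR_scaled B p x0.
have d1 : is_derive x 1 (fun y => sigma * t - B * y `^ p)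
    (- (B * (p * x `^ (p - 1)))).
  exact: is_derive_eq (is_deriveB (is_derive_cst (sigma * t : R^o) _ _) dp)
    (sub0r _).
exact: is_derive_eq (is_deriveB d1 (is_derive_cst (K : R^o) _ _)) (subr0 _).
Qed.

Lemma is_derive_wave_x (R : realType) (L b a sigma B p K t x : R) :
  0 < a -> 0 < x ->
  is_derive x 1 (wave L b a sigma B p K t)
    (- (B * (p * x `^ (p - 1))) *
     front' L b a (sigma * t - B * x `^ p - K)).
Proof.
move=> a0 x0; have dxi := is_derive_wave_arg sigma B p K t x0.
have dfr := is_derive_front L b (sigma * t - B * x `^ p - K) a0.
rewrite mulrC.
exact: (@is_derive1_comp R (front L b a)
  (fun y => sigma * t - B * y `^ p - K) x _ _ dfr dxi).
Qed.

Lemma is_derive_wave_xx (R : realType) (L b a sigma B p K t x : R) :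
  0 < a -> 0 < x ->
  is_derive x 1 (fun y => - (B * (p * y `^ (p - 1))) *
       front' L b a (sigma * t - B * y `^ p - K))
    ((B * (p * x `^ (p - 1))) ^+ 2 *
       front'' L b a (sigma * t - B * x `^ p - K) +
     B * (p * (1 - p) * x `^ (p - 1 - 1)) *
       front' L b a (sigma * t - B * x `^ p - K)).
Proof.
move=> a0 x0; have dxi := is_derive_wave_arg sigma B p K t x0.
have dfr := is_derive_front' L b (sigma * t - B * x `^ p - K) a0.
have dcomp := @is_derive1_comp R (front' L b a)
  (fun y => sigma * t - B * y `^ p - K) x _ _ dfr dxi.
have dpow : is_derive x 1 (fun y => - (B * (p * y `^ (p - 1))))
    (- (B * p) * ((p - 1) * x `^ (p - 1 - 1))).
  have -> : (fun y => - (B * (p * y `^ (p - 1)))) =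
      (fun y => - (B * p) * y `^ (p - 1)).
    by apply/funext => y; ring.
  exact: is_derive_powR_scaled.
apply: is_derive_eq (is_deriveM dpow dcomp) _.
rewrite /GRing.scale /=; ring.
Qed.

Lemma continuous_wave (R : realType) (L b a sigma B p K : R) (q : R * R) :
  0 < a -> 0 < q.2 ->
  {for q, continuous (fun q : R * R => wave L b a sigma B p K q.1 q.2)}.
Proof.
move=> a0 q0.
have c1 : {for q, continuous (fun q : R * R => sigma * q.1)}.
  by apply: continuousM; [exact: cst_continuous|exact: cvg_fst].
have c2 : {for q, continuous (fun q : R * R => B * q.2 `^ p)}.
  have cs : {for q, continuous (fun q : R * R => q.2)} by exact: cvg_snd.
  exact: (continuous_comp cs
    (is_derive_continuous (is_derive_powR_scaled B p q0))).
have carg : {for q, continuous (fun q : R * R => sigma * q.1 - B * q.2 `^ p - K)}.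
  apply: continuousB; last exact: cst_continuous.
  exact: (continuousB c1 c2).
have cfr := is_derive_continuous
  (is_derive_front L b (sigma * q.1 - B * q.2 `^ p - K) a0).
exact: (continuous_comp carg cfr).
Qed.

(** The concavity of x^p gives a nonnegative contribution to the second space
derivative, so only its square-slope part, at most 1 in front of front'',
remains.  The half-line is cut at a point y so far that the wave is below d
up to time t, and e, hence d, is arbitrary. *)
Lemma wave_below_solution (R : realType) (f u0 : R -> R) (u : R -> R -> R)
    (M L b a rho B p K X : R) :
  is_solution f u0 u -> 0 <= M ->
  (forall x y, 0 <= x <= 1 -> 0 <= y <= 1 -> x <= y ->
     f y - f x <= M * (y - x)) ->
  0 < L <= 1 -> 0 < b -> 0 < a -> 0 <= rho -> 0 < B -> 0 < p <= 1 -> 0 < X ->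
  (forall x, X <= x -> B * (p * x `^ (p - 1)) <= 1) ->
  (forall eta xi, 0 <= eta <= 1 ->
     rho * b * front' L b a xi <= eta * front'' L b a xi + f (front L b a xi)) ->
  (forall x, X <= x -> wave L b a (rho * b) B p K 0 x <= u 0 x) ->
  (forall t, 0 <= t -> wave L b a (rho * b) B p K t X <= u t X) ->
  forall t x, 0 <= t -> X <= x -> wave L b a (rho * b) B p K t x <= u t x.
Proof.
move=> sol M0 f_lip /andP[L0 L1] b0 a0 rho0 B0 /andP[p0 p1] X0 slope sub
  v_init v_left t x t0 Xx.
apply/ler_addgt0Pr => e e0.
pose d := e * expR (- ((M + 1) * t)).
have d0 : 0 < d by rewrite mulr_gt0 ?expR_gt0.
have -> : e = d * expR ((M + 1) * t).
  by rewrite /d -mulrA -expRD addNr expR0 mulr1.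
(* Chosen so that B * q = sigma t + |K| + d^(-b): beyond q^(1/p) the argument of
   front is at most - d^(-b). *)
pose q := (rho * b * t + `|K| + d `^ (- b)) / B.
have sigma0 : 0 <= rho * b by rewrite mulr_ge0 ?(ltW b0).
have q0 : 0 <= q.
  by rewrite divr_ge0 ?(ltW B0)// !addr_ge0 ?powR_ge0// mulr_ge0.
pose y := Num.max x (q `^ p^-1).
have xy : x <= y by rewrite le_max lexx.
have qy : q <= y `^ p.
  have qE : (q `^ p^-1) `^ p = q by rewrite -powRrM mulVf ?gt_eqF// powRr1.
  rewrite -[leLHS]qE; apply: ge0_ler_powR; rewrite ?nnegrE ?powR_ge0 ?(ltW p0)//.
    by rewrite (le_trans (ltW X0))// (le_trans Xx).
  by rewrite le_max lexx orbT.
have u_ge0 s z : 0 <= s -> 0 <= u s z.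
  by move=> s0; case/andP: (@sol_range _ _ _ _ sol s z s0).
have pos z : X < z -> 0 < z by exact: lt_trans.
apply: (@comparison _ f u0 u (wave L b a (rho * b) B p K)
  (fun s z => rho * b * front' L b a (rho * b * s - B * z `^ p - K))
  (fun s z => - (B * (p * z `^ (p - 1))) *
     front' L b a (rho * b * s - B * z `^ p - K))
  (fun s z => (B * (p * z `^ (p - 1))) ^+ 2 *
       front'' L b a (rho * b * s - B * z `^ p - K) +
     B * (p * (1 - p) * z `^ (p - 1 - 1)) *
       front' L b a (rho * b * s - B * z `^ p - K))
  M d t X y sol M0 f_lip (ltW d0) t0 (le_trans Xx xy)).
- apply: continuous_in_subspaceT => -[s z]; rewrite inE => -[/= _].
  rewrite in_itv /= => /andP[Xz _]; apply: continuous_wave => //=.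
  exact: lt_le_trans Xz.
- by move=> s z _ _; exact: is_derive_wave_t.
- by move=> s z _ /andP[/pos z0 _]; exact: is_derive_wave_x.
- by move=> s z _ /andP[/pos z0 _]; exact: is_derive_wave_xx.
- move=> s z _ _; rewrite (ltW (front_gt0 _ _ _ a0))/=.
  exact: le_trans (ltW (front_ltL _ a0 b0 L0)) L1.
- move=> s z _ /andP[Xz _].
  set xi := rho * b * s - B * z `^ p - K.
  have slope0 : 0 <= B * (p * z `^ (p - 1)).
    by rewrite !mulr_ge0 ?powR_ge0 ?(ltW B0) ?(ltW p0).
  have := sub ((B * (p * z `^ (p - 1))) ^+ 2) xi.
  rewrite sqr_ge0 expr_le1// slope ?(ltW Xz)// => /(_ isT) sub_xi.
  have conv : 0 <= B * (p * (1 - p) * z `^ (p - 1 - 1)) * front' L b a xi.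
    rewrite mulr_ge0 ?front'_ge0// !mulr_ge0 ?powR_ge0 ?(ltW B0) ?(ltW p0)//.
    by rewrite subr_ge0.
  by rewrite /wave -/xi; move: sub_xi conv; lra.
- by move=> z /andP[Xz _]; rewrite ler_wpDr ?(ltW d0)// v_init.
- by move=> s /andP[s0 _]; rewrite ler_wpDr ?(ltW d0)// v_left.
- move=> s /andP[s0 st]; apply: ler_wpDl; first exact: u_ge0.
  apply: front_le => //.
  have := ler_norm (- K); rewrite normrN.
  have : rho * b * s <= rho * b * t by exact: ler_wpM2l.
  have : B * q <= B * y `^ p by rewrite ler_pM2l.
  by rewrite /q mulrCA mulfV ?gt_eqF// mulr1; lra.
- by rewrite t0 lexx.
- by rewrite Xx.
Qed.

(** * Choice of the parameters *)

Lemma reaction_small_lower_bound (R : realType) (f : R -> R)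
    (beta r r1 delta s0 L : R) :
  0 < delta -> 0 < s0 -> 0 < L -> r1 < r -> 0 < r ->
  (forall s, 0 <= s <= s0 -> r * s `^ beta * (1 - s `^ delta) <= f s) ->
  exists2 s1, 0 < s1 <= L & forall s, 0 < s <= s1 -> r1 * s `^ beta <= f s.
Proof.
move=> delta0 s00 L0 r1r r0 f_lower.
pose k := (r - r1) / r.
have k0 : 0 < k by rewrite divr_gt0// subr_gt0.
exists (Num.min (Num.min s0 L) (k `^ delta^-1)).
  by rewrite !lt_min s00 L0 powR_gt0//= !ge_min lexx orbT.
move=> s /andP[sgt0]; rewrite !le_min => /andP[/andP[ss0 _] sk].
apply: le_trans (f_lower s _); last by rewrite ltW.
have sdelta : s `^ delta <= k.
  have kE : (k `^ delta^-1) `^ delta = k.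
    by rewrite -powRrM mulVf ?gt_eqF// powRr1// ltW.
  rewrite -[leRHS]kE.
  by apply: ge0_ler_powR; rewrite ?nnegrE ?powR_ge0 ?(ltW delta0) ?(ltW sgt0).
rewrite mulrAC ler_pM2r ?powR_gt0//.
have : r * s `^ delta <= r * k by rewrite ler_pM2l.
by rewrite /k mulrCA mulfV ?gt_eqF//; lra.
Qed.

Lemma reaction_bounded_below (R : realType) (f : R -> R) (s1 L : R) :
  {within `[0, 1], continuous f} -> (forall s, 0 < s < 1 -> 0 < f s) ->
  0 < s1 <= L -> L < 1 ->
  exists2 c, 0 < c & forall s, s1 <= s < L -> c <= f s.
Proof.
move=> fc f_gt0 /andP[s10 s1L] L1.
have fcL : {within `[s1, L], continuous f}.
  apply: continuous_subspaceW fc => z /=; rewrite !in_itv /= => /andP[? ?].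
  by apply/andP; split; lra.
have [c c01 cmin] := EVT_min s1L fcL.
exists (f c).
  move: c01; rewrite in_itv /= => /andP[? ?].
  by apply: f_gt0; apply/andP; split; lra.
by move=> s /andP[s1s sL]; apply: cmin; rewrite in_itv /= s1s ltW.
Qed.

(** Here p < 1 is essential: the slope of B x^p tends to 0 at infinity. *)
Lemma power_slope_le1 (R : realType) (B p x0 : R) :
  0 < B -> 0 < p < 1 -> 0 < x0 -> exists2 X, x0 <= X &
    forall x, X <= x -> B * (p * x `^ (p - 1)) <= 1.
Proof.
move=> B0 /andP[p0 p1] x00; pose k := 1 - p.
have k0 : 0 < k by rewrite subr_gt0.
have Bp0 : 0 < B * p by rewrite mulr_gt0.
exists (Num.max x0 ((B * p) `^ k^-1)); first by rewrite le_max lexx.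
move=> x; rewrite ge_max => /andP[_ xk].
have -> : p - 1 = - k by rewrite /k; ring.
have := le_powRN (ltW k0) (powR_gt0 _ Bp0) xk.
rewrite -powRrM mulrN mulVf ?gt_eqF// powR_inv1 ?(ltW Bp0)// => xle.
by rewrite mulrA -(mulfV (lt0r_neq0 Bp0)) ler_pM2l.
Qed.

(** * The lower bound on the level sets *)

Theorem theorem2p5 (R : realType) (f u0 : R -> R) (u : R -> R -> R)
    (* reaction term *)
    (f_C1 : C1_on `[0, 1] f)
    (f0 : f 0 = 0) (f1 : f 1 = 0)
    (f_gt0 : forall s : R, 0 < s < 1 -> 0 < f s)
    (df0 : has_derivative_in `[0, 1] f 0 0)
    (* initial datum *)
    (u0_range : forall x : R, 0 <= u0 x <= 1)
    (u0_unif : unif_continuous u0)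
    (u0_gt0 : forall x : R, 0 < u0 x)
    (u0_ninfty : (0 < limf_einf (fun x => (u0 x)%:E) (ninfty_nbhs R))%E)
    (u0_pinfty : u0 x @[x --> +oo] --> (0 : R))
    (u_sol : is_solution f u0 u)
    (* the fixed gamma and the fixed times t_lambda *)
    (gamma : R) (gamma_gt0 : 0 < gamma)
    (gammaP : inf [set u t x | x in [set x | x <= gamma * t]] @[t --> +oo]
                --> (1 : R))
    (t_ : R -> R)
    (t_P : forall lambda : R, 0 < lambda < 1 ->
       0 < t_ lambda /\
       forall t : R, t_ lambda <= t ->
         level_set u lambda t !=set0 /\
         level_set u lambda t `<=` [set x | gamma * t < x])
    (alpha beta : R) (alpha_gt0 : 0 < alpha) (beta_gt1 : 1 < beta)
    (beta_lt : beta < 1 + 1 / alpha)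
    (C x0 : R) (C_gt0 : 0 < C) (x0_gt1 : 1 < x0)
    (u0_tail : forall x : R, x0 <= x -> C / x `^ alpha <= u0 x)
    (r delta s0 : R) (r_gt0 : 0 < r) (delta_gt0 : 0 < delta)
    (s0_01 : 0 < s0 < 1)
    (f_lower : forall s : R, 0 <= s <= s0 ->
       r * s `^ beta * (1 - s `^ delta) <= f s) :
  forall lambda epsilon : R, 0 < lambda < 1 -> 0 < epsilon < r ->
  exists2 T : R, t_ lambda <= T &
    forall t : R, T <= t ->
      level_set u lambda t `<=`
        [set x | ((r - epsilon) * C `^ (beta - 1) * (beta - 1) * t)
                   `^ (1 / (alpha * (beta - 1))) < x].
Proof.
move=> lambda epsilon lambda01 /andP[eps0 epsr].
have /andP[lambda0 lambda1] := lambda01.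
have [s00 s01] := andP s0_01.
pose b := beta - 1; pose p := alpha * b; pose B := C `^ (- b).
pose L := (1 + lambda) / 2; pose rho := r - epsilon / 2.
have b0 : 0 < b by rewrite subr_gt0.
have B0 : 0 < B by exact: powR_gt0.
have L0 : 0 < L by rewrite /L; lra.
have L1 : L < 1 by rewrite /L; lra.
have lambdaL : lambda < L by rewrite /L; lra.
have rho0 : 0 < rho by rewrite /rho; lra.
have p01 : 0 < p < 1.
  rewrite mulr_gt0//=; have : b < alpha^-1 by rewrite /b; lra.
  by rewrite /p mulrC -ltr_pdivlMr// div1r.
have /andP[p0 p1] := p01.
have [M M0 f_lip] := C1_on_lipschitz f_C1.
have f_ge0 s : 0 <= s <= 1 -> 0 <= f s.
  case/andP; rewrite le_eqVlt => /orP[/eqP<-|s_gt0]; first by rewrite f0.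
  rewrite le_eqVlt => /orP[/eqP->|s_lt1]; first by rewrite f1.
  by rewrite ltW// f_gt0// s_gt0.
have [s1 s1L f_small] := @reaction_small_lower_bound R f beta r
  (r - epsilon / 4) delta s0 L delta_gt0 s00 L0 ltac:(lra) r_gt0 f_lower.
have [c c0 f_large] :=
  reaction_bounded_below (C1_on_continuous f_C1) f_gt0 s1L L1.
have /andP[s10 _] := s1L.
have bV0 : 0 < b^-1 by rewrite invr_gt0.
have s1b0 : 0 < s1 `^ (- b) by exact: powR_gt0.
(* The two entries are what front_subsolution asks for, with
   r1 - rho = epsilon / 4. *)
pose a := Num.max (b^-1 / (epsilon / 4)) ((rho * s1 `^ (- b) + b^-1) / c).
have a0 : 0 < a by rewrite lt_max divr_gt0// divr_gt0.
have profile eta xi : 0 <= eta <= 1 ->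
    rho * b * front' L b a xi <= eta * front'' L b a xi + f (front L b a xi).
  apply: (@front_subsolution R f L b a rho (r - epsilon / 4) s1 c) => //.
  - by rewrite L0 ltW.
  - exact: ltW.
  - rewrite ler_pdivrMr// /rho.
    have : b^-1 / (epsilon / 4) <= a by rewrite le_max lexx.
    rewrite ler_pdivrMr ?divr_gt0// => /le_trans; apply.
    by rewrite mulrC ler_pM2r//; lra.
  - rewrite ler_pdivrMr// (mulrC c) -ler_pdivrMr//.
    by rewrite le_max lexx orbT.
  - have -> : 1 + b = beta by rewrite /b; ring.
    exact: f_small.
have [X x0X slope] := power_slope_le1 B0 p01 (lt_trans ltr01 x0_gt1).
have X0 : 0 < X by apply: lt_le_trans x0X; lra.
have [t1 t1_X u_large] : exists2 t1, X / gamma <= t1 &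
    forall t x, t1 <= t -> x <= gamma * t -> L <= u t x.
  have [A [_ AP]] := cvgr_gt _ gammaP L L1.
  exists (Num.max (X / gamma) (A + 1)) => [|t x]; first by rewrite le_max lexx.
  rewrite ge_max => /andP[Xt At] xt.
  have t_ge0 : 0 <= t by apply: le_trans Xt; rewrite divr_ge0 ?ltW.
  apply: le_trans (ltW (AP t _)) _ => /=; first by lra.
  apply: ge_inf; last by exists x.
  by exists 0 => _ [y _ <-]; case/andP: (@sol_range _ _ _ _ u_sol t y t_ge0).
have t1_gt0 : 0 < t1 by apply: lt_le_trans t1_X; exact: divr_gt0.
have [m m0 u_pos] := @solution_lower_bound R f u0 u M X t1 u_sol M0 f_lip f_ge0
  u0_gt0 (unif_continuous_continuous u0_unif) (ltW t1_gt0).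
(* Until time t1 the argument of front stays below - m^(-b), i.e. the wave
   stays below m. *)
pose K := rho * b * t1 + m `^ (- b).
have K0 : 0 <= K by rewrite addr_ge0 ?powR_ge0// !mulr_ge0// ltW.
have below := @wave_below_solution R f u0 u M L b a rho B p K X u_sol M0 f_lip
  _ b0 a0 (ltW rho0) B0 _ X0 slope profile.
have {}below t x : 0 <= t -> X <= x -> wave L b a (rho * b) B p K t x <= u t x.
  move=> t0 Xx; apply: below => //.
  - by rewrite L0 ltW.
  - by rewrite p0 ltW.
  - move=> y Xy; rewrite (sol_init u_sol); apply: le_trans (u0_tail y _).
    + have y0 : 0 < y by exact: lt_le_trans Xy.
      apply: front_le => //; first by rewrite divr_gt0// powR_gt0.
      have -> : (C / y `^ alpha) `^ (- b) = B * y `^ p.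
        rewrite -powRN powRM ?powR_ge0 ?(ltW C_gt0)//.
        by rewrite -powRrM mulrNN.
      by rewrite mulr0; lra.
    + exact: le_trans Xy.
    (* On x = X: the saturation level after t1, the shift K before. *)
  - move=> s s_ge0; have [t1s|st1] := leP t1 s.
      apply: le_trans (u_large s X t1s _).
        exact: ltW (front_ltL _ a0 b0 L0).
      by rewrite mulrC -ler_pdivrMr// (le_trans t1_X).
    apply: le_trans (u_pos s _); last by rewrite s_ge0 ltW.
    apply: front_le => //.
    have : rho * b * s <= rho * b * t1.
      by rewrite ler_wpM2l ?mulr_ge0 ?ltW.
    have : 0 <= B * X `^ p by rewrite mulr_ge0 ?powR_ge0 ?ltW.
    by rewrite /K; lra.
have [xi0 front_large] := @front_gt_near_limit R L b a lambda a0 b0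
  ltac:(by rewrite lambda0).
have [tl0 tlP] := t_P lambda lambda01.
(* The three constraints on t: level sets lie beyond gamma t; gamma t >= X; the
   gain epsilon / 2 * b * t compensates the shift K and the offset xi0. *)
pose T := Num.max (t_ lambda) (Num.max (X / gamma)
  ((K + xi0) / (epsilon / 2 * b))).
exists T; first by rewrite le_max lexx.
move=> t; rewrite !ge_max => /and3P[t_tl t_X t_K] x ux /=.
rewrite ltNge; apply/negP => x_le.
have t0 : 0 < t by exact: lt_le_trans t_tl.
have gx : gamma * t < x by exact: (tlP t t_tl).2.
have Xx : X <= x.
  by apply: le_trans (ltW gx); rewrite mulrC -ler_pdivrMr.
have x_gt0 : 0 < x by exact: lt_le_trans Xx.
have Bxp : B * x `^ p <= (r - epsilon) * b * t.
  have : x `^ p <= (r - epsilon) * C `^ b * b * t.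
    have A0 : 0 <= (r - epsilon) * C `^ b * b * t.
      by rewrite !mulr_ge0 ?powR_ge0 ?ltW// subr_gt0.
    have AE : (((r - epsilon) * C `^ b * b * t) `^ (1 / p)) `^ p =
        (r - epsilon) * C `^ b * b * t.
      by rewrite -powRrM mul1r mulVf ?gt_eqF// powRr1.
    rewrite -[leRHS]AE; apply: ge0_ler_powR; rewrite ?nnegrE ?powR_ge0//.
    - exact: ltW.
    - exact: ltW.
  rewrite -(ler_pM2l B0) => /le_trans; apply.
  rewrite /B powRN.
  have Cb0 : C `^ b != 0 by rewrite gt_eqF// powR_gt0.
  by rewrite le_eqVlt; apply/orP; left; apply/eqP; field.
have /front_large : xi0 <= rho * b * t - B * x `^ p - K.
  move: t_K; rewrite ler_pdivrMr ?mulr_gt0 ?divr_gt0//.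
  by move: Bxp; rewrite /rho; lra.
rewrite ltNge => /negP; apply.
by have := below t x (ltW t0) Xx; rewrite ux.
Qed.
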